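(* Let $\mathcal A$ be a unital associative algebra over $\mathbb C$, $\mathcal S$ its unshuffle spreadability system and $K_n$ the associated cumulants (see context). (i) A sequence $(\mathcal A_i)_{i=1}^\infty$ of subalgebras of $\mathcal A$ is $\mathcal S$-independent if and only if the subalgebras $\mathcal A_1,\mathcal A_2,\dots$ commute mutually, i.e. $XY=YX$ for all $X\in\mathcal A_i$, $Y\in\mathcal A_j$, $i\ne j$. This is equivalent to $K_2(X,Y)=0$ whenever $X\in\mathcal A_i$, $Y\in\mathcal A_j$ with $i\ne j$. (ii) Let $n\ge2$ be fixed. If $\{X_1,\dots,X_n\}\subseteq\mathcal A$ splits into two mutually commuting families (i.e. there is $\emptyset\subsetneq I\subsetneq\{1,\dots,n\}$ such that $X_iX_j=X_jX_i$ for all $i\in I$, $j\notin I$), then $K_n(X_1,X_2,\dots,X_n)=0$.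
   Context: Ordered set partitions. $\mathbb N=\{1,2,\dots\}$. An ordered set partition of $[n]=\{1,\dots,n\}$ is a sequence $\pi=(P_1,\dots,P_p)$ of pairwise disjoint nonempty blocks with union $[n]$; $\mathcal{OP}_n$ is the set of them. The quasi-meet of $\pi=(P_1,\dots,P_p)$ and $\sigma=(S_1,\dots,S_s)$ is $\pi\curlywedge\sigma=(P_1\cap S_1,P_1\cap S_2,\dots,P_1\cap S_s,P_2\cap S_1,\dots,P_p\cap S_s)$ with empty sets removed. The ordered kernel $\kappa(i_1,\dots,i_n)\in\mathcal{OP}_n$ has as blocks the level sets $\{k:i_k=v\}$ listed in increasing order of $v$. For $P=\{p_1<\dots<p_k\}$ put $X_P=X_{p_1}\cdots X_{p_k}$. Unshuffle spreadability system $\mathcal S=(\mathcal U,\tilde\varphi,(\iota^{(j)})_{j\ge1})$. $\varphi=\mathrm{Id}:\mathcal A\to\mathcal A$, $\mathcal U=\bigotimes_{i=1}^\infty\mathcal A$ (algebraic infinite tensor product of unital algebras), $\iota^{(j)}(X)=X^{(j)}=1^{\otimes(j-1)}\otimes X\otimes1^{\otimes\infty}$, $\tilde\varphi:\mathcal U\to\mathcal A$ linear with $\tilde\varphi(X_1\otimes\cdots\otimes X_k\otimes1^{\otimes\infty})=X_1\cdots X_k$. For $\pi=(P_1,\dots,P_p)\in\mathcal{OP}_n$, $\varphi_\pi(X_1,\dots,X_n)=\tilde\varphi(X_1^{(i_1)}\cdots X_n^{(i_n)})=X_{P_1}\cdots X_{P_p}$ for any indices with $\kappa(i_1,\dots,i_n)=\pi$.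 $\mathcal S$-independence. $(\mathcal A_i)_{i=1}^\infty$ is $\mathcal S$-independent if for any $n$, any $(i_1,\dots,i_n)\in\mathbb N^n$, any $X_j\in\mathcal A_{i_j}$ and any $\pi\in\mathcal{OP}_n$ one has $\varphi_\pi(X_1,\dots,X_n)=\varphi_{\pi\curlywedge\kappa(i_1,\dots,i_n)}(X_1,\dots,X_n)$. Cumulants. $\tilde\varphi\big((\sum_{i=1}^NX_1^{(i)})\cdots(\sum_{i=1}^NX_n^{(i)})\big)$ is a polynomial in $N\in\mathbb N$ with coefficients in $\mathcal A$; $K_n(X_1,\dots,X_n)$ is the coefficient of $N$ in it. *)

(* Defs.v *)
From HB Require Import structures.
From mathcomp Require Import all_boot all_order all_algebra.
From mathcomp Require Import boolp.

Set Implicit Arguments.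
Unset Strict Implicit.
Unset Printing Implicit Defensive.

Import Order.TTheory GRing.Theory Num.Theory.
Local Open Scope ring_scope.
Local Open Scope quotient_scope.

(* The infinite algebraic tensor product of copies of A.  An elementary tensor
   X_0 ⊗ ... ⊗ X_(k-1) ⊗ 1 ⊗ 1 ⊗ ... is represented by the finite sequence
   [:: X_0; ...; X_(k-1)] (tensor positions are numbered from 0), so sequences
   differing by trailing 1s represent the same tensor. *)
Section InfiniteTensor.
Variables (K : comNzRingType) (A : algType K).

Definition multilinear (W : lmodType K) (m : seq A -> W) : Prop :=
  (forall s t a x y,
     m (s ++ (a *: x + y) :: t) = a *: m (s ++ x :: t) + m (s ++ y :: t)) /\
  (forall s, m (rcons s 1) = m s).

Local Notation fsum := (seq (K * seq A)).

Definition fsum_eval (W : lmodType K) (m : seq A -> W) (u : fsum) : W :=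
  \sum_(p <- u) p.1 *: m p.2.

(* Two formal linear combinations of elementary tensors are identified iff
   no multilinear map separates them, i.e. iff their difference is in the span
   of the multilinearity relations. *)
Definition fsum_equiv : rel fsum := fun u v =>
  `[< forall (W : lmodType K) (m : seq A -> W),
        multilinear m -> fsum_eval m u = fsum_eval m v >].

Lemma fsum_equiv_is_equiv : equiv_class_of fsum_equiv.
Proof.
split=> [u|u v|v u w].
- by apply/asboolP.
- by apply/asboolP/asboolP => h W m hm; rewrite h.
- by move=> /asboolP h1 /asboolP h2; apply/asboolP => W m hm; rewrite h1 ?h2.
Qed.

Canonical fsum_equiv_equiv := EquivRelPack fsum_equiv_is_equiv.
Canonical fsum_equiv_enc := defaultEncModRel fsum_equiv.

Definition tensor : Type := {eq_quot fsum_equiv}.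

HB.instance Definition _ : EqQuotient fsum fsum_equiv tensor :=
  EqQuotient.on tensor.
HB.instance Definition _ := Choice.on tensor.

Lemma tensor_eqP (u v : fsum) :
  (forall (W : lmodType K) (m : seq A -> W),
     multilinear m -> fsum_eval m u = fsum_eval m v) <->
  \pi_tensor u = \pi_tensor v.
Proof.
split=> [h|/eqP]; first by apply/eqP; rewrite piE; apply/asboolP.
by rewrite piE => /asboolP.
Qed.

Lemma repr_eval (u : fsum) (W : lmodType K) (m : seq A -> W) :
  multilinear m -> fsum_eval m (repr (\pi_tensor u)) = fsum_eval m u.
Proof. by apply: (tensor_eqP _ _).2; rewrite reprK. Qed.

Lemma fsum_eval_cat (W : lmodType K) (m : seq A -> W) (u v : fsum) :
  fsum_eval m (u ++ v) = fsum_eval m u + fsum_eval m v.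
Proof. exact: big_cat. Qed.

Definition fsum_scale (a : K) (u : fsum) : fsum :=
  [seq (a * p.1, p.2) | p <- u].

Lemma fsum_eval_scale (W : lmodType K) (m : seq A -> W) a (u : fsum) :
  fsum_eval m (fsum_scale a u) = a *: fsum_eval m u.
Proof.
rewrite /fsum_eval big_map scaler_sumr.
by apply: eq_bigr => p _ /=; rewrite scalerA.
Qed.

Fixpoint seq_mul (s t : seq A) : seq A :=
  match s, t with
  | x :: s', y :: t' => x * y :: seq_mul s' t'
  | [::], _ => t
  | _, [::] => s
  end.

Definition fsum_mul (u v : fsum) : fsum :=
  [seq (p.1 * q.1, seq_mul p.2 q.2) | p <- u, q <- v].

Lemma nth_seq_mul s t i : nth 1 (seq_mul s t) i = nth 1 s i * nth 1 t i.
Proof.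
elim: s t i => [|x s IH] [|y t] [|i] //=; rewrite ?nth_nil ?mulr1 ?mul1r //.
Qed.

Lemma seq_mulA : associative seq_mul.
Proof.
by elim=> [|x s IH] [|y t] [|z r] //=; rewrite mulrA IH.
Qed.

Lemma seq_mul0 s : seq_mul s [::] = s. Proof. by case: s. Qed.

Lemma seq_mul_cat s1 s2 t1 t2 : size s1 = size t1 ->
  seq_mul (s1 ++ s2) (t1 ++ t2) = seq_mul s1 t1 ++ seq_mul s2 t2.
Proof. by elim: s1 t1 => [|x s IH] [|y t] //= [/IH ->]. Qed.

Section Multilinear.
Variables (W : lmodType K) (m : seq A -> W) (hm : multilinear m).

Lemma multilinear_pad s k : m (s ++ nseq k 1) = m s.
Proof.
elim: k => [|k IH]; first by rewrite cats0.
by rewrite -addn1 nseqD /= catA cats1 (hm.2) IH.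
Qed.

Lemma multilinear_nth s t : nth 1 s =1 nth 1 t -> m s = m t.
Proof.
move=> h; rewrite -(multilinear_pad s (size t - size s)).
rewrite -(multilinear_pad t (size s - size t)); congr m.
have hsz : size (s ++ nseq (size t - size s) 1) =
           size (t ++ nseq (size s - size t) 1).
  by rewrite !size_cat !size_nseq -!maxnE maxnC.
apply: (@eq_from_nth _ 1) => // i _.
rewrite !nth_cat !nth_nseq !if_same.
case: ltnP => hs; case: ltnP => ht //.
- by rewrite h nth_default.
- by rewrite -h nth_default.
Qed.

Let pad (t : seq A) p := mkseq (nth 1 t) p.

Lemma pad_nth t p : nth 1 (pad t p ++ nth 1 t p :: drop p.+1 t) =1 nth 1 t.
Proof.
move=> i; rewrite nth_cat size_mkseq; case: ltnP => hi.
  by rewrite nth_mkseq.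
have [->|hne] := eqVneq i p; first by rewrite subnn.
have hlt : (p < i)%N by rewrite ltn_neqAle eq_sym hne.
by rewrite -(subnSK hlt) /= nth_drop subnKC.
Qed.

Lemma multilinear_mull t : multilinear (fun s => m (seq_mul s t)).
Proof.
split=> [s r a x y|s]; last first.
  apply: multilinear_nth => i; rewrite !nth_seq_mul nth_rcons.
  by case: ltnP => // h; rewrite if_same (nth_default _ h).
have E z : m (seq_mul (s ++ z :: r) t) =
   m (seq_mul s (pad t (size s)) ++
      z * nth 1 t (size s) :: seq_mul r (drop (size s).+1 t)).
  rewrite -[z * _ :: _]/(seq_mul (z :: r) (nth 1 t (size s) :: drop (size s).+1 t)).
  rewrite -seq_mul_cat ?size_mkseq //; apply: multilinear_nth => i.
  by rewrite !nth_seq_mul pad_nth.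
by rewrite !E mulrDl -scalerAl hm.1.
Qed.

Lemma multilinear_mulr s : multilinear (fun t => m (seq_mul s t)).
Proof.
split=> [t r a x y|t]; last first.
  apply: multilinear_nth => i; rewrite !nth_seq_mul nth_rcons.
  by case: ltnP => // h; rewrite if_same (nth_default _ h).
have E z : m (seq_mul s (t ++ z :: r)) =
   m (seq_mul (pad s (size t)) t ++
      nth 1 s (size t) * z :: seq_mul (drop (size t).+1 s) r).
  rewrite -[_ * z :: _]/(seq_mul (nth 1 s (size t) :: drop (size t).+1 s) (z :: r)).
  rewrite -seq_mul_cat ?size_mkseq //; apply: multilinear_nth => i.
  by rewrite !nth_seq_mul pad_nth.
by rewrite !E mulrDr -scalerAr hm.1.
Qed.

Lemma fsum_eval_mull u v :
  fsum_eval m (fsum_mul u v) =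
  fsum_eval (fun s => fsum_eval (fun t => m (seq_mul s t)) v) u.
Proof.
rewrite /fsum_eval /fsum_mul big_allpairs_dep; apply: eq_bigr => p _.
by rewrite scaler_sumr; apply: eq_bigr => q _; rewrite scalerA.
Qed.

Lemma fsum_eval_mulr u v :
  fsum_eval m (fsum_mul u v) =
  fsum_eval (fun t => fsum_eval (fun s => m (seq_mul s t)) u) v.
Proof.
rewrite fsum_eval_mull /fsum_eval.
under eq_bigr do rewrite scaler_sumr.
rewrite exchange_big; apply: eq_bigr => q _ /=.
rewrite scaler_sumr; apply: eq_bigr => p _.
by rewrite !scalerA mulrC.
Qed.

End Multilinear.

Lemma eq_fsum_eval (W : lmodType K) (m m' : seq A -> W) u :
  m =1 m' -> fsum_eval m u = fsum_eval m' u.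
Proof. by move=> h; apply: eq_bigr => p _; rewrite h. Qed.

Definition tensor_zero : tensor := \pi_tensor [::].
Definition tensor_add (u v : tensor) : tensor := \pi_tensor (repr u ++ repr v).
Definition tensor_scale (a : K) (u : tensor) : tensor :=
  \pi_tensor (fsum_scale a (repr u)).
Definition tensor_opp (u : tensor) : tensor := tensor_scale (-1) u.
Definition tensor_one : tensor := \pi_tensor [:: (1, [::])].
Definition tensor_mul (u v : tensor) : tensor :=
  \pi_tensor (fsum_mul (repr u) (repr v)).

Lemma pi_add (u v : fsum) :
  tensor_add (\pi_tensor u) (\pi_tensor v) = \pi_tensor (u ++ v).
Proof.
apply/tensor_eqP => W m hm.
by rewrite !fsum_eval_cat !repr_eval.
Qed.

Lemma pi_scale a (u : fsum) :
  tensor_scale a (\pi_tensor u) = \pi_tensor (fsum_scale a u).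
Proof.
by apply/tensor_eqP => W m hm; rewrite !fsum_eval_scale repr_eval.
Qed.

Lemma pi_mul (u v : fsum) :
  tensor_mul (\pi_tensor u) (\pi_tensor v) = \pi_tensor (fsum_mul u v).
Proof.
apply/tensor_eqP => W m hm; rewrite fsum_eval_mull.
transitivity (fsum_eval (fun s => fsum_eval (fun t => m (seq_mul s t)) v)
                (repr (\pi_tensor u))).
  by apply: eq_fsum_eval => s; apply: repr_eval; apply: multilinear_mulr.
rewrite -fsum_eval_mull !fsum_eval_mulr.
by apply: eq_fsum_eval => t; apply: repr_eval; apply: multilinear_mull.
Qed.

Lemma tensorW (P : tensor -> Prop) :
  (forall u : fsum, P (\pi_tensor u)) -> forall x, P x.
Proof. by move=> h x; rewrite -[x]reprK. Qed.

Fact tensor_addA : associative tensor_add.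
Proof.
elim/tensorW=> u; elim/tensorW=> v; elim/tensorW=> w.
by rewrite !pi_add catA.
Qed.

Fact tensor_addC : commutative tensor_add.
Proof.
elim/tensorW=> u; elim/tensorW=> v; rewrite !pi_add.
by apply/tensor_eqP => W m hm; rewrite !fsum_eval_cat addrC.
Qed.

Fact tensor_add0 : left_id tensor_zero tensor_add.
Proof. by elim/tensorW=> u; rewrite pi_add. Qed.

Fact tensor_addN : left_inverse tensor_zero tensor_opp tensor_add.
Proof.
elim/tensorW=> u; rewrite /tensor_opp pi_scale pi_add.
apply/tensor_eqP => W m hm.
by rewrite fsum_eval_cat fsum_eval_scale scaleN1r addNr /fsum_eval big_nil.
Qed.

HB.instance Definition _ := GRing.isZmodule.Build tensor
  tensor_addA tensor_addC tensor_add0 tensor_addN.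

Fact tensor_mulA : associative tensor_mul.
Proof.
elim/tensorW=> u; elim/tensorW=> v; elim/tensorW=> w; rewrite !pi_mul.
apply/tensor_eqP => W m hm; rewrite !fsum_eval_mull //.
apply: eq_fsum_eval => s; rewrite fsum_eval_mull //.
by apply: eq_fsum_eval => t; apply: eq_fsum_eval => r; rewrite seq_mulA.
Qed.

Lemma fsum_eval1 (W : lmodType K) (m : seq A -> W) s :
  fsum_eval m [:: (1, s)] = m s.
Proof. by rewrite /fsum_eval big_seq1 scale1r. Qed.

Fact tensor_mul1l : left_id tensor_one tensor_mul.
Proof.
elim/tensorW=> u; rewrite pi_mul; apply/tensor_eqP => W m hm.
by rewrite fsum_eval_mull // fsum_eval1.
Qed.

Fact tensor_mul1r : right_id tensor_one tensor_mul.
Proof.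
elim/tensorW=> u; rewrite pi_mul; apply/tensor_eqP => W m hm.
rewrite fsum_eval_mulr // fsum_eval1.
by apply: eq_fsum_eval => s; rewrite seq_mul0.
Qed.

Fact tensor_mulDl : left_distributive tensor_mul tensor_add.
Proof.
elim/tensorW=> u; elim/tensorW=> v; elim/tensorW=> w.
rewrite !(pi_mul, pi_add); apply/tensor_eqP => W m hm.
by rewrite fsum_eval_cat !fsum_eval_mull // fsum_eval_cat.
Qed.

Fact tensor_mulDr : right_distributive tensor_mul tensor_add.
Proof.
elim/tensorW=> u; elim/tensorW=> v; elim/tensorW=> w.
rewrite !(pi_mul, pi_add); apply/tensor_eqP => W m hm.
by rewrite fsum_eval_cat !fsum_eval_mulr // fsum_eval_cat.
Qed.

Lemma prod_seq_multilinear : multilinear (fun s : seq A => \prod_(x <- s) x).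
Proof.
split=> [s t a x y|s]; last by rewrite -cats1 big_cat big_seq1 /= mulr1.
by rewrite !big_cat !big_cons /= mulrDl mulrDr -scalerAl -scalerAr.
Qed.

Fact tensor_oner_neq0 : tensor_one != tensor_zero.
Proof.
apply/eqP => /tensor_eqP /(_ _ _ prod_seq_multilinear) /eqP.
by rewrite fsum_eval1 /fsum_eval !big_nil oner_eq0.
Qed.

HB.instance Definition _ := GRing.Zmodule_isNzRing.Build tensor
  tensor_mulA tensor_mul1l tensor_mul1r tensor_mulDl tensor_mulDr
  tensor_oner_neq0.

Fact tensor_scaleA a b x :
  tensor_scale a (tensor_scale b x) = tensor_scale (a * b) x.
Proof.
elim/tensorW: x => u; rewrite !pi_scale; apply/tensor_eqP => W m hm.
by rewrite !fsum_eval_scale scalerA.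
Qed.

Fact tensor_scale1 : left_id 1 tensor_scale.
Proof.
elim/tensorW=> u; rewrite !pi_scale; apply/tensor_eqP => W m hm.
by rewrite !fsum_eval_scale scale1r.
Qed.

Fact tensor_scaleDr : right_distributive tensor_scale +%R.
Proof.
move=> a; elim/tensorW=> u; elim/tensorW=> v.
rewrite -[_ + _]/(tensor_add _ _) -[RHS]/(tensor_add _ _).
rewrite !(pi_scale, pi_add); apply/tensor_eqP => W m hm.
by rewrite !(fsum_eval_cat, fsum_eval_scale) scalerDr.
Qed.

Fact tensor_scaleDl x : {morph tensor_scale^~ x : a b / a + b}.
Proof.
move=> a b; elim/tensorW: x => u; rewrite -[RHS]/(tensor_add _ _).
rewrite !(pi_scale, pi_add); apply/tensor_eqP => W m hm.
by rewrite !(fsum_eval_cat, fsum_eval_scale) scalerDl.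
Qed.

HB.instance Definition _ := GRing.Zmodule_isLmodule.Build K tensor
  tensor_scaleA tensor_scale1 tensor_scaleDr tensor_scaleDl.

Fact tensor_scaleAl a (x y : tensor) : a *: (x * y) = (a *: x) * y.
Proof.
rewrite -[LHS]/(tensor_scale a (tensor_mul x y)).
rewrite -[RHS]/(tensor_mul (tensor_scale a x) y).
elim/tensorW: x => u; elim/tensorW: y => v.
rewrite !(pi_mul, pi_scale, pi_mul); apply/tensor_eqP => W m hm.
by rewrite fsum_eval_scale !fsum_eval_mull // fsum_eval_scale.
Qed.

HB.instance Definition _ := GRing.Lmodule_isLalgebra.Build K tensor
  tensor_scaleAl.

Fact tensor_scaleAr a (x y : tensor) : a *: (x * y) = x * (a *: y).
Proof.
rewrite -[LHS]/(tensor_scale a (tensor_mul x y)).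
rewrite -[RHS]/(tensor_mul x (tensor_scale a y)).
elim/tensorW: x => u; elim/tensorW: y => v.
rewrite !(pi_mul, pi_scale, pi_mul); apply/tensor_eqP => W m hm.
by rewrite fsum_eval_scale !fsum_eval_mulr // fsum_eval_scale.
Qed.

HB.instance Definition _ := GRing.Lalgebra_isAlgebra.Build K tensor
  tensor_scaleAr.

(* The elementary tensor s_0 ⊗ s_1 ⊗ ... ⊗ 1 ⊗ 1 ⊗ ... *)
Definition tens (s : seq A) : tensor := \pi_tensor [:: (1, s)].

Lemma tens_multilinear : multilinear tens.
Proof.
split=> [s t a x y|s]; last first.
  by apply/tensor_eqP => W m hm; rewrite !fsum_eval1 hm.2.
rewrite -[RHS]/(tensor_add (tensor_scale _ _) _) pi_scale pi_add.
apply/tensor_eqP => W m hm.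
by rewrite fsum_eval_cat fsum_eval_scale !fsum_eval1 hm.1.
Qed.

Lemma tensM s t : tens s * tens t = tens (seq_mul s t).
Proof.
rewrite -[LHS]/(tensor_mul _ _) pi_mul; apply/tensor_eqP => W m hm.
by rewrite fsum_eval_mull // !fsum_eval1.
Qed.

Lemma tens1 : tens [::] = 1. Proof. by []. Qed.

(* The universal property of the tensor product. *)
Definition tensor_lift (W : lmodType K) (m : seq A -> W) (x : tensor) : W :=
  fsum_eval m (repr x).

Lemma tensor_lift_tens (W : lmodType K) (m : seq A -> W) s :
  multilinear m -> tensor_lift m (tens s) = m s.
Proof. by move=> hm; rewrite /tensor_lift repr_eval // fsum_eval1. Qed.

Lemma tensor_lift_linear (W : lmodType K) (m : seq A -> W) :
  multilinear m -> linear (tensor_lift m).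
Proof.
move=> hm a; elim/tensorW=> u; elim/tensorW=> v.
rewrite /tensor_lift -[_ + _ in LHS]/(tensor_add (tensor_scale _ _) _).
by rewrite pi_scale pi_add !repr_eval // fsum_eval_cat fsum_eval_scale.
Qed.

Lemma tensor_span (x : tensor) : x = \sum_(p <- repr x) p.1 *: tens p.2.
Proof.
rewrite -[LHS]reprK; elim: (repr x) => [|p u IH]; first by rewrite big_nil.
rewrite big_cons -IH -[RHS]/(tensor_add (tensor_scale _ _) _).
rewrite pi_scale pi_add; apply/tensor_eqP => W m hm /=.
by rewrite /fsum_eval !big_cons /= mulr1.
Qed.

Lemma tensor_lift_unique (W : lmodType K) (m : seq A -> W)
    (f : {linear tensor -> W}) :
  (forall s, f (tens s) = m s) -> f =1 tensor_lift m.
Proof.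
move=> h x; rewrite [in LHS](tensor_span x) linear_sum.
by apply: eq_bigr => p _; rewrite linearZ /= h.
Qed.

End InfiniteTensor.

Arguments tens {K A} s.

Section OrderedSetPartitions.
Variable n : nat.
Implicit Types (pi sigma : seq {set 'I_n}).

(* In ordered set partitions of 'I_n the elements are numbered from 0. *)
Definition ordered_set_partition pi : bool :=
  uniq pi && partition [set P in pi] [set: 'I_n].

Definition quasi_meet pi sigma : seq {set 'I_n} :=
  [seq B <- [seq P :&: Q | P <- pi, Q <- sigma] | B != set0].

Definition ordered_kernel (i : 'I_n -> nat) : seq {set 'I_n} :=
  [seq [set k | i k == v] | v <- sort leq (undup (codom i))].

(* The position in pi of the block that contains k. *)
Definition block_index pi (k : 'I_n) : nat := find (fun P : {set _} => k \in P) pi.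

End OrderedSetPartitions.

Section Unshuffle.
Variables (K : comNzRingType) (A : algType K).

Definition incl (j : nat) (x : A) : tensor A := tens (rcons (nseq j 1) x).

Definition phi_tilde : tensor A -> A :=
  tensor_lift (fun s : seq A => \prod_(x <- s) x).

Lemma phi_tilde_is_linear : linear phi_tilde.
Proof. exact/tensor_lift_linear/prod_seq_multilinear. Qed.

HB.instance Definition _ :=
  GRing.isLinear.Build K (tensor A) A _ phi_tilde phi_tilde_is_linear.

Lemma phi_tilde_tens s : phi_tilde (tens s) = \prod_(x <- s) x.
Proof. exact/tensor_lift_tens/prod_seq_multilinear. Qed.

Lemma incl_is_linear j : linear (incl j).
Proof. by move=> a x y; rewrite /incl -!cats1 (tens_multilinear A).1. Qed.

Lemma tens_nth (s t : seq A) : nth 1 s =1 nth 1 t -> tens s = tens t.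
Proof. exact/multilinear_nth/tens_multilinear. Qed.

Lemma nth_incl j (x : A) i :
  nth 1 (rcons (nseq j 1) x) i = if i == j then x else 1.
Proof.
rewrite nth_rcons size_nseq nth_nseq if_same.
by case: ltngtP.
Qed.

Lemma incl_is_monoid_morphism j : monoid_morphism (incl j).
Proof.
split=> [|x y]; first by apply: tens_nth => i; rewrite nth_incl nth_nil if_same.
rewrite /incl tensM; apply: tens_nth => i; rewrite nth_seq_mul !nth_incl.
by case: eqP; rewrite ?mulr1.
Qed.

Definition phi n (pi : seq {set 'I_n}) (X : 'I_n -> A) : A :=
  phi_tilde (\prod_(k < n) incl (block_index pi k) (X k)).

Lemma prod_incl n (i : 'I_n -> nat) (X : 'I_n -> A) N :
  (forall k, i k < N)%N ->
  \prod_(k < n) incl (i k) (X k) =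
  tens (mkseq (fun j => \prod_(k < n | i k == j) X k) N).
Proof.
move=> hN; elim: (index_enum _) => [|k r IH].
  rewrite big_nil -tens1; apply: tens_nth => j; rewrite nth_nil.
  case: (ltnP j N) => h; last by rewrite nth_default ?size_mkseq.
  by rewrite nth_mkseq // big_nil.
rewrite big_cons IH tensM; apply: tens_nth => j.
rewrite nth_seq_mul nth_incl; case: (ltnP j N) => h; last first.
  rewrite !nth_default ?size_mkseq // mulr1.
  by case: eqP (hN k) => // <-; rewrite ltnNge h.
by rewrite !nth_mkseq // big_cons eq_sym; case: eqP; rewrite ?mul1r.
Qed.

Lemma phi_tilde_prod_incl n (i : 'I_n -> nat) (X : 'I_n -> A) N :
  (forall k, i k < N)%N ->
  phi_tilde (\prod_(k < n) incl (i k) (X k)) =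
  \prod_(j < N) \prod_(k < n | i k == j) X k.
Proof.
move=> hN; rewrite (prod_incl _ hN) phi_tilde_tens big_map.
rewrite -(big_mkord xpredT (fun j => \prod_(k < n | i k == j) X k)).
by rewrite /index_iota subn0.
Qed.

Lemma ordered_kernelE n (i : 'I_n -> nat) N :
  (forall k, i k < N)%N ->
  ordered_kernel i =
  [seq B <- [seq [set k | i k == v] | v <- iota 0 N] | B != set0].
Proof.
move=> hN; rewrite filter_map; congr map.
apply: (@sorted_eq _ leq leq_trans anti_leq).
- exact: (sort_sorted leq_total).
- apply: sorted_filter; first exact: leq_trans.
  exact: (sub_sorted ltnW (iota_ltn_sorted 0 N)).
rewrite perm_sort; apply: uniq_perm.
- exact: undup_uniq.
- exact/filter_uniq/iota_uniq.
move=> v; rewrite mem_undup mem_filter mem_iota /= add0n.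
apply/codomP/andP => [[k ->]|[/set0Pn[k]]].
  by split=> //; apply/set0Pn; exists k; rewrite inE.
by rewrite inE => /eqP <- _; exists k.
Qed.

Lemma phi_tilde_kernel n (i : 'I_n -> nat) (X : 'I_n -> A) :
  phi_tilde (\prod_(k < n) incl (i k) (X k)) =
  \prod_(P <- ordered_kernel i) \prod_(k in P) X k.
Proof.
pose N := (\max_k i k).+1.
have hN k : (i k < N)%N by rewrite ltnS leq_bigmax.
rewrite (phi_tilde_prod_incl _ hN) (ordered_kernelE hN) big_filter big_map.
rewrite -(big_mkord xpredT (fun j => \prod_(k < n | i k == j) X k)).
rewrite [RHS]big_mkcond /index_iota subn0; apply: eq_bigr => v _.
have -> : \prod_(k < n | i k == v) X k = \prod_(k in [set k | i k == v]) X k.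
  by apply: eq_bigl => k; rewrite inE.
by case: eqP => //= ->; rewrite big_set0.
Qed.

Lemma kernel_block_index n (pi : seq {set 'I_n}) :
  ordered_set_partition pi -> ordered_kernel (block_index pi) = pi.
Proof.
case/andP=> uniq_pi /and3P[/eqP cov_pi triv_pi].
rewrite inE => pi_n0.
have has_pi k : has (fun P : {set _} => k \in P) pi.
  have: k \in cover [set P in pi] by rewrite cov_pi inE.
  by case/bigcupP=> P; rewrite inE => hP hk; apply/hasP; exists P.
have hN k : (block_index pi k < size pi)%N by rewrite -has_find.
have E v : (v < size pi)%N -> [set k | block_index pi k == v] = nth set0 pi v.
  move=> hv; apply/setP => k; rewrite inE; apply/eqP/idP => [<-|hk].
    exact: (nth_find set0 (has_pi k)).
  apply/eqP; rewrite -(nth_uniq set0 (hN k) hv uniq_pi).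
  apply/negPn/negP => hne.
  have := trivIsetP triv_pi (nth set0 pi (block_index pi k)) (nth set0 pi v).
  rewrite !inE !mem_nth // => /(_ isT isT hne) /pred0P /(_ k) /=.
  by rewrite hk (nth_find set0 (has_pi k)).
rewrite (ordered_kernelE hN).
have -> : [seq [set k | block_index pi k == v] | v <- iota 0 (size pi)] = pi.
  rewrite -[RHS](mkseq_nth set0); apply/eq_in_map => v.
  by rewrite mem_iota => /E.
by apply/all_filterP/allP => P hP; apply: contraNneq pi_n0 => <-.
Qed.

(* The value of phi is X_{P_1} ... X_{P_p}, and it can be computed with any
   indices of the given ordered kernel. *)
Lemma phiE n (pi : seq {set 'I_n}) (X : 'I_n -> A) :
  ordered_set_partition pi -> phi pi X = \prod_(P <- pi) \prod_(k in P) X k.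
Proof. by move=> h; rewrite /phi phi_tilde_kernel kernel_block_index. Qed.

Lemma ordered_kernelP n (i : 'I_n -> nat) :
  ordered_set_partition (ordered_kernel i).
Proof.
apply/andP; split.
  rewrite map_inj_in_uniq ?sort_uniq ?undup_uniq // => v w.
  rewrite !mem_sort !mem_undup => /codomP[k ->] _ /setP /(_ k).
  by rewrite !inE eqxx => /esym/eqP.
have mem P : reflect (exists k, P = [set l | i l == i k])
               (P \in [set P in ordered_kernel i]).
  rewrite inE; apply: (iffP mapP) => [[v]|[k ->]].
    by rewrite mem_sort mem_undup => /codomP[k ->] ->; exists k.
  by exists (i k); rewrite // mem_sort mem_undup codom_f.
apply/and3P; split.
- apply/eqP/setP => k; rewrite inE; apply/bigcupP.
  exists [set l | i l == i k]; last by rewrite inE.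
  by apply/mem; exists k.
- apply/trivIsetP => _ _ /mem[k ->] /mem[l ->]; apply: contraNT => /pred0Pn[j].
  by rewrite /= !inE => /andP[/eqP<- /eqP<-].
- apply/negP => /mem[k] /setP /(_ k).
  by rewrite !inE eqxx.
Qed.

Lemma phi_kernel n (i : 'I_n -> nat) (X : 'I_n -> A) :
  phi_tilde (\prod_(k < n) incl (i k) (X k)) = phi (ordered_kernel i) X.
Proof. by rewrite phi_tilde_kernel phiE // ordered_kernelP. Qed.

Lemma quasi_meetP n (pi sigma : seq {set 'I_n}) :
  ordered_set_partition pi -> ordered_set_partition sigma ->
  ordered_set_partition (quasi_meet pi sigma).
Proof.
have block (tau : seq {set 'I_n}) : ordered_set_partition tau ->
    (forall k, exists2 P, P \in tau & k \in P) /\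
    (forall P Q k, P \in tau -> Q \in tau -> k \in P -> k \in Q -> P = Q).
  case/andP=> _ /and3P[/eqP cov /trivIsetP triv _]; split=> [k|P Q k hP hQ kP kQ].
    have: k \in cover [set P in tau] by rewrite cov inE.
    by case/bigcupP=> P; rewrite inE; exists P.
  apply/eqP/negPn/negP => hne; have := triv P Q.
  by rewrite !inE => /(_ hP hQ hne)/pred0P/(_ k) /=; rewrite kP kQ.
move=> hpi hsigma.
have [covp injp] := block _ hpi; have [covs injs] := block _ hsigma.
have memE (B : {set 'I_n}) : reflect
    (exists P Q, [/\ P \in pi, Q \in sigma, B = P :&: Q & B != set0])
    (B \in quasi_meet pi sigma).
  rewrite mem_filter; apply: (iffP andP) => [[B0 /allpairsPdep[P [Q [hP hQ e]]]]|].
    by exists P, Q.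
  by move=> [P [Q [hP hQ -> B0]]]; split=> //; apply: allpairs_f.
apply/andP; split.
  rewrite /quasi_meet -[[seq _ | P <- _, Q <- _]](map_allpairs (fun p => p.1 :&: p.2)
    (fun P Q => (P, Q))) filter_map map_inj_in_uniq.
    apply/filter_uniq/allpairs_uniq; try by case/andP: hpi; case/andP: hsigma.
    by move=> [? ?] [? ?] _ _ [-> ->].
  move=> [P Q] [P' Q']; rewrite !mem_filter /=.
  move=> /andP[/set0Pn[k kPQ]] /allpairsPdep[? [? [hP hQ [? ?]]]]; subst.
  move=> /andP[_ /allpairsPdep[? [? [hP' hQ' [? ?]]]]] e; subst.
  move: kPQ (kPQ); rewrite {1}e !inE => /andP[k1 k2] /andP[k3 k4].
  by congr (_, _); [exact: injp k3 k1 | exact: injs k4 k2].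
apply/and3P; split.
- apply/eqP/setP => k; rewrite inE; apply/bigcupP.
  have [P hP kP] := covp k; have [Q hQ kQ] := covs k.
  exists (P :&: Q); last by rewrite inE kP.
  rewrite inE; apply/memE; exists P, Q; split=> //.
  by apply/set0Pn; exists k; rewrite inE kP.
- apply/trivIsetP => B C; rewrite !inE => /memE[P [Q [hP hQ -> _]]].
  move=> /memE[P' [Q' [hP' hQ' -> _]]]; apply: contraNT => /pred0Pn[k].
  rewrite /= !inE => /andP[/andP[k1 k2] /andP[k3 k4]].
  by rewrite (injp _ _ _ hP hP' k1 k3) (injs _ _ _ hQ hQ' k2 k4).
- by rewrite inE; apply/negP => /memE[P [Q [_ _ _ /eqP]]].
Qed.

(* Subalgebras are not required to contain the unit of A. *)
Definition subalgebra (B : {pred A}) : Prop :=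
  GRing.submod_closed B /\ GRing.mulr_2closed B.

Definition S_independent (B : nat -> {pred A}) : Prop :=
  forall n (i : 'I_n -> nat) (X : 'I_n -> A),
    (forall k, X k \in B (i k)) ->
    forall pi : seq {set 'I_n}, ordered_set_partition pi ->
    phi pi X = phi (quasi_meet pi (ordered_kernel i)) X.

End Unshuffle.

Section Cumulants.
Variables (K : numFieldType) (A : algType K).

Definition phi_sum n (X : 'I_n -> A) (N : nat) : A :=
  phi_tilde (\prod_(k < n) \sum_(j < N) incl j (X k)).

Definition is_phi_sum_poly n (X : 'I_n -> A) (p : {poly A}) : Prop :=
  forall N : nat, (0 < N)%N -> phi_sum X N = p.[N%:R].

(* A polynomial over the possibly noncommutative A is determined by its values
   at the positive integers, which are central in A. *)
Lemma poly_nat_inj (p q : {poly A}) :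
  (forall N : nat, (0 < N)%N -> p.[N%:R] = q.[N%:R]) -> p = q.
Proof.
move=> h; apply/eqP; rewrite -subr_eq0; apply/eqP.
have {h}: forall N : nat, (0 < N)%N -> (p - q).[N%:R] = 0.
  by move=> N hN; rewrite hornerD hornerN h ?subrr.
move: (p - q) 0%N => {p q} p; move sz: (size p) => s.
elim: s p sz => [|s IH] p sz m hm; first by apply/eqP; rewrite -size_poly_eq0 sz.
have /factor_theorem[r def_p] : root p m.+1%:R by apply/rootP/hm.
have [r0|r0] := eqVneq r 0; first by rewrite def_p r0 mul0r.
have sz_r : size r = s.
  by apply: succn_inj; rewrite -sz def_p size_Mmonic ?monicXsubC // size_XsubC addn2.
suff /eqP : r = 0 by rewrite (negPf r0).
apply: (IH _ sz_r m.+1) => N hN; have := hm N (ltnW hN).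
rewrite def_p hornerM_comm; last exact/esym/commr_nat.
rewrite hornerXsubC -natrB ?(ltnW hN) // => /eqP.
have -> : (N - m.+1)%:R = (N - m.+1)%:R%:A :> A by rewrite scaler_nat.
rewrite -scalerAr mulr1 scaler_eq0 pnatr_eq0 subn_eq0 leqNgt hN /=.
by move/eqP.
Qed.

Lemma bin_poly m : {p : {poly K} | forall N : nat, p.[N%:R] = 'C(N, m)%:R}.
Proof.
exists ((m`!)%:R^-1 *: \prod_(i < m) ('X - i%:R%:P)) => N.
have fact_neq0 : (m`!)%:R != 0 :> K by rewrite pnatr_eq0 -lt0n fact_gt0.
rewrite hornerZ horner_prod; apply: (mulfI fact_neq0).
rewrite mulrA divff // mul1r -natrM mulnC bin_ffact ffact_prod.
case: (leqP m N) => h.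
  rewrite natr_prod; apply: eq_bigr => i _.
  by rewrite hornerXsubC natrB // ltnW // (leq_trans (ltn_ord i)).
rewrite (bigD1 (Ordinal h)) //= hornerXsubC subrr mul0r.
by rewrite (bigD1 (Ordinal h)) //= subnn mul0n.
Qed.

Lemma phi_sumE n (X : 'I_n -> A) N :
  phi_sum X N =
  \sum_(f : {ffun 'I_n -> 'I_N}) phi_tilde (\prod_(k < n) incl (f k) (X k)).
Proof. by rewrite /phi_sum bigA_distr_bigA linear_sum. Qed.

Lemma ordered_kernel_mono n (i : 'I_n -> nat) (h : nat -> nat) :
  {in codom i &, {mono h : v w / (v <= w)%N}} ->
  ordered_kernel (h \o i) = ordered_kernel i.
Proof.
move=> mono_h; rewrite /ordered_kernel.
have inj_h : {in codom i &, injective h}.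
  move=> v w hv hw e; apply/eqP; rewrite eqn_leq.
  by rewrite -(mono_h v w) // -(mono_h w v) // e leqnn.
have -> : sort leq (undup (codom (h \o i))) =
          map h (sort leq (undup (codom i))).
  apply: (@sorted_eq _ leq leq_trans anti_leq).
  - exact: (sort_sorted leq_total).
  - apply: (@homo_sorted_in _ _ (mem (codom i)) h leq leq).
    + by move=> v w hv hw; rewrite mono_h.
    + by apply/allP => v; rewrite mem_sort mem_undup.
    + exact: (sort_sorted leq_total).
  rewrite perm_sort; apply: uniq_perm; first exact: undup_uniq.
    rewrite map_inj_in_uniq ?sort_uniq ?undup_uniq // => v w.
    by rewrite !mem_sort !mem_undup; apply: inj_h.
  move=> v; rewrite mem_undup; apply/codomP/mapP => [[k ->]|[w]].
    by exists (i k); rewrite // mem_sort mem_undup codom_f.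
  by rewrite mem_sort mem_undup => /codomP[k ->] ->; exists k.
rewrite -map_comp; apply/eq_in_map => v; rewrite mem_sort mem_undup => hv.
apply/setP => k; rewrite !inE /=; apply/eqP/eqP => [|-> //].
by apply: inj_h => //; apply: codom_f.
Qed.

(* Spreadability. *)
Lemma phi_tilde_mono n (X : 'I_n -> A) (i : 'I_n -> nat) (h : nat -> nat) :
  {in codom i &, {mono h : v w / (v <= w)%N}} ->
  phi_tilde (\prod_(k < n) incl (h (i k)) (X k)) =
  phi_tilde (\prod_(k < n) incl (i k) (X k)).
Proof.
move=> hm.
by rewrite (phi_tilde_kernel (h \o i)) phi_tilde_kernel ordered_kernel_mono.
Qed.

Lemma phi_sum_image n (X : 'I_n -> A) N (E : {set 'I_N}) :
  \sum_(f : {ffun 'I_n -> 'I_N} | [set f k | k : 'I_n] == E)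
    phi_tilde (\prod_(k < n) incl (f k) (X k)) =
  \sum_(g : {ffun 'I_n -> 'I_#|E|} | [set g k | k : 'I_n] == setT)
    phi_tilde (\prod_(k < n) incl (g k) (X k)).
Proof.
pose h (g : {ffun 'I_n -> 'I_#|E|}) := [ffun k => enum_val (g k)].
have inj_h : injective h.
  by move=> g g' /ffunP e; apply/ffunP => k; have := e k; rewrite !ffunE => /enum_val_inj.
pose e := [seq val x | x <- enum E].
have sz_e : size e = #|E| by rewrite size_map -cardE.
have sorted_e : sorted ltn e.
  apply: (subseq_sorted ltn_trans _ (iota_ltn_sorted 0 N)).
  rewrite -val_enum_ord; apply: map_subseq.
  by rewrite enumT; apply: filter_subseq.
have val_e (j : 'I_#|E|) : nth 0%N e j = enum_val j.
  by rewrite (nth_map (enum_default j)) // -cardE.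
transitivity (\sum_(f in [set h g | g in [set g : {ffun 'I_n -> 'I_#|E|} |
    [set g k | k : 'I_n] == setT]]) phi_tilde (\prod_(k < n) incl (f k) (X k))).
  apply: eq_bigl => f; apply/eqP/imsetP => [imf|[g]].
    have hf k : f k \in E by rewrite -imf imset_f.
    exists [ffun k => enum_rank_in (hf k) (f k)]; last first.
      by apply/ffunP => k; rewrite !ffunE enum_rankK_in.
    rewrite inE; apply/eqP/setP => j; rewrite inE; apply/imsetP.
    have /imsetP[k _ ej] : enum_val j \in [set f k | k : 'I_n].
      by rewrite imf enum_valP.
    exists k => //.
    by apply: enum_val_inj; rewrite ffunE enum_rankK_in.
  rewrite inE => /eqP img ->; apply/setP => x; apply/imsetP/idP => [[k _ ->]|hx].
    by rewrite ffunE enum_valP.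
  have : enum_rank_in hx x \in [set g k | k : 'I_n] by rewrite img inE.
  by move=> /imsetP[k _ ek]; exists k; rewrite // ffunE -ek enum_rankK_in.
rewrite big_imset /=; last by move=> g g' _ _; apply: inj_h.
apply: eq_big => [g|g _]; first by rewrite inE.
rewrite -(@phi_tilde_mono n X (fun k => g k) (nth 0%N e)).
  by congr phi_tilde; apply: eq_bigr => k _; rewrite ffunE val_e.
move=> _ _ /codomP[k ->] /codomP[l ->].
apply: (leq_mono_in (sorted_ltn_nth ltn_trans 0%N sorted_e));
  by rewrite inE sz_e ltn_ord.
Qed.

(* The multiplicity of a pattern with p distinct indices is binomial(N, p). *)
Lemma phi_sum_bin n (X : 'I_n -> A) N :
  phi_sum X N = \sum_(p < n.+1) 'C(N, p)%:R *:
     \sum_(g : {ffun 'I_n -> 'I_p} | [set g k | k : 'I_n] == setT)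
       phi_tilde (\prod_(k < n) incl (g k) (X k)) :> A.
Proof.
pose im (f : {ffun 'I_n -> 'I_N}) : {set 'I_N} := [set f k | k : 'I_n].
have le_im f : (#|im f| < n.+1)%N by rewrite ltnS -[n in (_ <= n)%N]card_ord leq_imset_card.
rewrite phi_sumE (partition_big (fun f => inord #|im f| : 'I_n.+1) xpredT) //.
apply: eq_bigr => p _.
rewrite (partition_big im (fun E => #|E| == p)); last first.
  by move=> f /= /eqP <-; rewrite inordK.
rewrite -[X in 'C(X, _)]card_ord -card_draws -sum1_card natr_sum scaler_suml.
apply: eq_big => [E|E /eqP hE]; first by rewrite inE.
rewrite scale1r -hE -phi_sum_image.
apply: eq_bigl => f; rewrite -/(im f).
case: (im f =P E) => imE; rewrite ?andbF // andbT.
by apply/eqP/val_inj; rewrite /= inordK // imE.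
Qed.

Lemma phi_sum_poly_ex n (X : 'I_n -> A) : exists p, is_phi_sum_poly X p.
Proof.
pose c p : A := \sum_(g : {ffun 'I_n -> 'I_p} | [set g k | k : 'I_n] == setT)
       phi_tilde (\prod_(k < n) incl (g k) (X k)).
exists (\sum_(p < n.+1) (c p)%:P * map_poly (in_alg A) (sval (bin_poly p))).
move=> N _; rewrite phi_sum_bin horner_sum; apply: eq_bigr => p _.
rewrite hornerCM -(rmorph_nat (in_alg A)) horner_map /= (svalP (bin_poly p)).
by rewrite -scalerAr mulr1.
Qed.

Definition phi_sum_poly n (X : 'I_n -> A) : {poly A} :=
  sval (cid (phi_sum_poly_ex X)).

Lemma phi_sum_polyP n (X : 'I_n -> A) (p : {poly A}) :
  is_phi_sum_poly X p <-> p = phi_sum_poly X.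
Proof.
have h := svalP (cid (phi_sum_poly_ex X)).
split=> [hp|-> //]; apply: poly_nat_inj => N hN.
by rewrite -hp // h.
Qed.

Definition cumulant n (X : 'I_n -> A) : A := (phi_sum_poly X)`_1.

End Cumulants.

(* Main.v *)
Require Import Defs.
From HB Require Import structures.
From mathcomp Require Import all_boot all_order all_algebra.
From mathcomp Require Import complex reals.

Set Implicit Arguments.
Unset Strict Implicit.
Unset Printing Implicit Defensive.

Import Order.TTheory GRing.Theory Num.Theory.
Local Open Scope ring_scope.

(** Everything rests on the fact that the state phi_tilde multiplies the tensor
    slots in increasing order, so that it only notices how the factors of a
    product commute with each other.

    Independence.  Passing from pi to its quasi-meet with the kernel of
    (i_1, ..., i_n) sorts the factors inside each block of pi by their label
    i_k.  If differently labelled factors commute, sorting does not change the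
    product (prod_fibers).  Conversely, for the one-block partition of two
    elements with decreasing labels, sorting swaps the two factors, so that
    independence reads X Y = Y X.

    The second cumulant.  The state maps X^(j) Y^(l) to X Y if j <= l and to
    Y X otherwise.  Adding to the sum over (j, l) the same sum with j and l
    exchanged gives N^2 (X Y + Y X) + N (X Y - Y X), whence
    2 K_2(X, Y) = X Y - Y X (cumulant2).

    Vanishing of mixed cumulants.  Let the family X split into two commuting
    subfamilies.  In the tensor algebra the sums over N copies of the two
    subfamilies commute as well, and the state is multiplicative on products of
    commuting tensors (phi_tilde_tensM), so the polynomial defining the
    cumulant is the product of the polynomials of the two subfamilies
    (phi_sum_split).  Both subfamilies are nonempty, so both polynomials vanish
    at N = 0: an empty sum is a factor.  Hence their product has no linear
    term. *)

(** * Ordered products of partially commuting factors *)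

(** The factors in Q can be moved to the front one at a time, since each of
    them only has to pass factors outside Q. *)
Lemma prod_split_comm (S : nzRingType) (I : Type) (r : seq I) (P Q : pred I)
    (F : I -> S) :
  (forall k l, Q k -> ~~ Q l -> GRing.comm (F k) (F l)) ->
  \prod_(k <- r | P k) F k =
  \prod_(k <- r | P k && Q k) F k * \prod_(k <- r | P k && ~~ Q k) F k.
Proof.
move=> commF; elim: r => [|k r IH]; first by rewrite !big_nil mulr1.
rewrite !big_cons IH; case: (P k) => //=; case: ifPn => Qk /=.
  by rewrite mulrA.
have commFk : GRing.comm (F k) (\prod_(l <- r | P l && Q l) F l).
  by apply: commr_prod => l /andP[_ Ql]; apply/commr_sym/commF.
by rewrite mulrA commFk mulrA.
Qed.

(** This is stable sorting by labels: the splitting lemma takes out the fibers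
    one after the other, in the order of s, and leaves the relative order of
    equally labelled factors as it is. *)
Lemma prod_fibers (S : nzRingType) (I : Type) (V : eqType) (r : seq I)
    (s : seq V) (P : pred I) (i : I -> V) (F : I -> S) :
  uniq s -> (forall k, P k -> i k \in s) ->
  (forall k l, i k != i l -> GRing.comm (F k) (F l)) ->
  \prod_(k <- r | P k) F k =
  \prod_(v <- s) \prod_(k <- r | P k && (i k == v)) F k.
Proof.
move=> + + commF; elim: s P => [|v s IH] P /= => [_ Ps|/andP[vs uniq_s] Ps].
  by rewrite big_nil big_pred0 // => k; apply/negP => /Ps.
rewrite big_cons (prod_split_comm _ _ (Q := fun k => i k == v)); last first.
  by move=> k l /eqP ik il; apply: commF; rewrite ik eq_sym.
congr (_ * _); rewrite IH // => [|k /andP[/Ps]]; last first.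
  by rewrite inE => /orP[->|].
apply: eq_big_seq => w ws; apply: eq_bigl => k.
by case: (i k =P w) => [->|]; rewrite ?andbF //= (memPn vs) ?andbT.
Qed.

(** The analogue of big_enum_val for a noncommutative product: enum_val lists
    the elements of B in the order of the ambient enumeration. *)
Lemma prod_enum_val (S : nzRingType) (I : finType) (B : {set I}) (F : I -> S) :
  \prod_(k in B) F k = \prod_(j < #|B|) F (enum_val j).
Proof.
rewrite -big_filter [index_enum I]unlock -(big_map F xpredT id).
rewrite (big_nth 1) size_map -cardE big_mkord.
by apply: eq_bigr => j _; rewrite nth_image.
Qed.

(** * The unshuffle state on products *)

Section State.
Variables (K : comNzRingType) (A : algType K).

(** In the product of the tensors, slot l of t stands to the left of slot j of
    s exactly when l < j; only such pairs have to be exchanged to bring all of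
    s before all of t. *)
Lemma phi_tilde_tensM (s t : seq A) :
  (forall j l, (l < j)%N -> GRing.comm (nth 1 s j) (nth 1 t l)) ->
  phi_tilde (tens s * tens t) = phi_tilde (tens s) * phi_tilde (tens t).
Proof.
rewrite tensM !phi_tilde_tens.
elim: s t => [|x s IH] [|y t] comm_st; rewrite ?big_nil ?mul1r ?mulr1 //=.
rewrite !big_cons IH => [|j l lt_lj]; last by apply: (comm_st j.+1 l.+1).
have comm_y : GRing.comm (\prod_(z <- s) z) y.
  apply/commr_sym; rewrite (big_nth 1) big_seq.
  by apply: commr_prod => j _; apply/commr_sym/(comm_st j.+1 0%N).
by rewrite -!mulrA; congr (_ * _); rewrite !mulrA comm_y.
Qed.

Lemma phi_tilde_incl j (x : A) : phi_tilde (incl j x) = x.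
Proof.
rewrite phi_tilde_tens -cats1 big_cat big_seq1 /= big1_seq ?mul1r //.
by move=> y /nseqP[].
Qed.

Lemma incl_comm j l (x y : A) :
  (j = l -> GRing.comm x y) -> GRing.comm (incl j x) (incl l y).
Proof.
move=> comm_xy; rewrite /GRing.comm /incl !tensM; apply: tens_nth => i.
rewrite !nth_seq_mul !nth_incl.
case: eqP => [->|_]; last by rewrite mulr1 mul1r.
by case: eqP => [e|_]; rewrite ?mulr1 ?mul1r //; apply: comm_xy.
Qed.

Lemma phi_tilde_incl2 j l (x y : A) :
  phi_tilde (incl j x * incl l y) = if (j <= l)%N then x * y else y * x.
Proof.
have ordered a b (u v : A) :
    (a <= b)%N -> phi_tilde (incl a u * incl b v) = u * v.
  move=> le_ab; rewrite phi_tilde_tensM ?phi_tilde_incl // => p q lt_qp.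
  rewrite !nth_incl; case: eqP => [ea|_]; last exact/commr_sym/commr1.
  case: eqP => [eb|_]; last exact: commr1.
  by move: lt_qp; rewrite ea eb ltnNge le_ab.
case: leqP => [|lt_lj]; first exact: ordered.
rewrite incl_comm ?ordered ?(ltnW lt_lj) // => e.
by rewrite e ltnn in lt_lj.
Qed.

(** An elementary tensor of incl factors has in each slot a product of some of
    the factors, so that commutation passes from the factors to the slots. *)
Lemma phi_tilde_prodM m n (X : 'I_m -> A) (Y : 'I_n -> A)
    (f : 'I_m -> nat) (g : 'I_n -> nat) :
  (forall k l, GRing.comm (X k) (Y l)) ->
  phi_tilde ((\prod_(k < m) incl (f k) (X k)) *
             (\prod_(l < n) incl (g l) (Y l))) =
  phi_tilde (\prod_(k < m) incl (f k) (X k)) *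
  phi_tilde (\prod_(l < n) incl (g l) (Y l)).
Proof.
move=> commXY.
have bound p (h : 'I_p -> nat) k : (h k < (\max_l h l).+1)%N.
  by rewrite ltnS leq_bigmax.
have slot p (h : 'I_p -> nat) (Z : 'I_p -> A) j :
    nth 1 (mkseq (fun i => \prod_(k < p | h k == i) Z k) (\max_l h l).+1) j =
    \prod_(k < p | h k == j) Z k.
  have [lt_j|le_j] := ltnP j (\max_l h l).+1; first by rewrite nth_mkseq.
  rewrite nth_default ?size_mkseq // big_pred0 // => k.
  by rewrite ltn_eqF // (leq_trans (bound _ h k)).
rewrite (prod_incl X (bound _ f)) (prod_incl Y (bound _ g)).
apply: phi_tilde_tensM => j l _; rewrite !slot.
apply: commr_prod => k _; apply/commr_sym; apply: commr_prod => i _.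
exact/commr_sym.
Qed.

End State.

(** * Independence *)

Section Independence.
Variables (K : comNzRingType) (A : algType K) (B : nat -> {pred A}).

Lemma quasi_meet_setT n (sigma : seq {set 'I_n}) :
  ordered_set_partition sigma -> quasi_meet [:: setT] sigma = sigma.
Proof.
case/andP=> _ /and3P[_ _]; rewrite inE => sigma_n0.
rewrite /quasi_meet /= cats0 (eq_map (@setTI _)) map_id.
by apply/all_filterP/allP => P hP; apply: contraNneq sigma_n0 => <-.
Qed.

(** The labels must decrease for the kernel to reverse the two factors; the
    relation to prove is symmetric in X and Y, so this loses nothing. *)
Lemma S_independent_comm :
  S_independent B ->
  forall i j, i != j ->
  forall X Y : A, X \in B i -> Y \in B j -> X * Y = Y * X.
Proof.
move=> indepB.
have later i j (X Y : A) : (j < i)%N -> X \in B i -> Y \in B j -> X * Y = Y * X.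
  move=> lt_ji BX BY.
  pose idx := tnth [tuple i; j]; pose Z := tnth [tuple X; Y].
  have part1 : ordered_set_partition [:: [set: 'I_2]].
    rewrite /ordered_set_partition /=; apply/and3P; split.
    - by rewrite /cover set_seq1 big_set1.
    - by apply/trivIsetP => P Q; rewrite !inE => /eqP-> /eqP-> /eqP.
    - by rewrite !inE eq_sym; apply/set0Pn; exists ord0.
  have BZ k : Z k \in B (idx k) by case: k => [[|[|k]] lt_k].
  have := indepB 2 idx Z BZ _ part1.
  rewrite quasi_meet_setT ?ordered_kernelP // -phi_kernel phiE // big_seq1.
  rewrite (eq_bigl xpredT) => [|k]; last by rewrite inE.
  by rewrite !big_ord_recl !big_ord0 !mulr1 phi_tilde_incl2 leqNgt lt_ji.
move=> i j; rewrite neq_ltn => /orP[lt_ij|lt_ji] X Y BX BY.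
  exact/esym/(later j i).
exact: (later i j).
Qed.

(** The quasi-meet refines each block P of pi by the level sets of the labels,
    and the subalgebras commute across different labels, so the product over P
    is the product of its sorted fibers. *)
Lemma comm_S_independent :
  (forall i j, i != j ->
   forall X Y : A, X \in B i -> Y \in B j -> X * Y = Y * X) ->
  S_independent B.
Proof.
move=> commB n i X BX pi part_pi.
rewrite !phiE ?quasi_meetP ?ordered_kernelP // big_filter.
(* Empty intersections contribute empty products. *)
have drop0 : forall r : seq {set 'I_n},
    \prod_(P <- r | P != set0) \prod_(k in P) X k =
    \prod_(P <- r) \prod_(k in P) X k.
  move=> r; rewrite big_mkcond; apply: eq_bigr => P _.
  by case: eqP => //= ->; rewrite big_set0.
rewrite drop0 big_allpairs_dep; apply: eq_bigr => P _; rewrite big_map.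
rewrite (@prod_fibers _ _ _ _ (sort leq (undup (codom i))) _ i) //.
- by apply: eq_bigr => v _; apply: eq_bigl => k; rewrite !inE.
- by rewrite sort_uniq undup_uniq.
- by move=> k _; rewrite mem_sort mem_undup codom_f.
- by move=> k l ikl; apply: (commB _ _ ikl).
Qed.

End Independence.

(** * Cumulants *)

Section Cumulants.
Variables (K : numFieldType) (A : algType K).

(** The polynomial is determined by its values at positive N; the binomial
    expansion of phi_sum shows that it also takes the expected value at N = 0,
    where the sums over copies are empty. *)
Lemma phi_sum_poly_horner n (X : 'I_n -> A) N :
  (phi_sum_poly X).[N%:R] = phi_sum X N.
Proof.
pose c p : A := \sum_(g : {ffun 'I_n -> 'I_p} | [set g k | k : 'I_n] == setT)
  phi_tilde (\prod_(k < n) incl (g k) (X k)).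
pose q := \sum_(p < n.+1) (c p)%:P * map_poly (in_alg A) (sval (bin_poly K p)).
have qE M : phi_sum X M = q.[M%:R].
  rewrite phi_sum_bin horner_sum; apply: eq_bigr => p _.
  rewrite hornerCM -(rmorph_nat (in_alg A)) horner_map /= (svalP (bin_poly K p)).
  by rewrite -scalerAr mulr1.
by rewrite qE -((phi_sum_polyP X q).1 (fun M _ => qE M)).
Qed.

Lemma phi_sum_poly_coef0 n (X : 'I_n -> A) :
  (0 < n)%N -> (phi_sum_poly X)`_0 = 0.
Proof.
case: n X => // n X _.
rewrite -horner_coef0 -[0]/(0%:R) phi_sum_poly_horner /phi_sum.
by rewrite big_ord_recl big_ord0 mul0r linear0.
Qed.

Lemma phi_sum_splitM m n (X : 'I_m -> A) (Y : 'I_n -> A) N :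
  (forall k l, GRing.comm (X k) (Y l)) ->
  phi_tilde ((\prod_(k < m) \sum_(j < N) incl j (X k)) *
             (\prod_(l < n) \sum_(j < N) incl j (Y l))) =
  phi_sum X N * phi_sum Y N.
Proof.
move=> commXY; rewrite !phi_sumE !bigA_distr_bigA !big_distrlr linear_sum.
apply: eq_bigr => f _; rewrite linear_sum; apply: eq_bigr => g _.
exact: phi_tilde_prodM.
Qed.

(** Distinct slots of the tensor algebra always commute, and equal slots inherit
    the commutation of the X_k, so the two groups of factors can be separated;
    the increasing enumerations of I and of its complement then turn each group
    into a family of its own. *)
Lemma phi_sum_split n (X : 'I_n -> A) (I : {set 'I_n}) N :
  (forall i j, i \in I -> j \notin I -> X i * X j = X j * X i) ->
  phi_sum X N = phi_sum (fun k : 'I_#|I| => X (enum_val k)) N *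
                phi_sum (fun k : 'I_#|~: I| => X (enum_val k)) N.
Proof.
move=> commX; rewrite -phi_sum_splitM => [|k l]; last first.
  apply: commX; first exact: enum_valP.
  by have := enum_valP l; rewrite inE.
pose Y (k : 'I_n) : tensor A := \sum_(j < N) incl j (X k).
rewrite /phi_sum (@prod_split_comm _ _ _ _ (fun k => k \in I) Y) /=.
  rewrite prod_enum_val -(prod_enum_val (~: I) Y).
  by congr (phi_tilde (_ * _)); apply: eq_bigl => k; rewrite inE.
move=> k l Ik Il; apply: commr_sum => i _; apply/commr_sym.
apply: commr_sum => j _; apply: incl_comm => _; exact/esym/commX.
Qed.

(** A product of two polynomials without constant term has no linear term. *)
Lemma cumulant_split0 n (X : 'I_n -> A) (I : {set 'I_n}) :
  I != set0 -> I \proper [set: 'I_n] ->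
  (forall i j, i \in I -> j \notin I -> X i * X j = X j * X i) ->
  cumulant X = 0.
Proof.
move=> I0 IT commX; rewrite /cumulant.
set p := phi_sum_poly (fun k : 'I_#|I| => X (enum_val k)).
set q := phi_sum_poly (fun k : 'I_#|~: I| => X (enum_val k)).
have <- : p * q = phi_sum_poly X.
  apply/(phi_sum_polyP X) => N _.
  rewrite hornerM_comm; last exact/esym/commr_nat.
  by rewrite !phi_sum_poly_horner -phi_sum_split.
have p0 : p`_0 = 0 by apply: phi_sum_poly_coef0; rewrite card_gt0.
have q0 : q`_0 = 0.
  apply: phi_sum_poly_coef0; rewrite card_gt0.
  by apply: contraTneq IT => I0'; rewrite properT -[I]setCK I0' setC0 eqxx.
by rewrite coefM !big_ord_recl big_ord0 /= p0 q0 mul0r mulr0 !addr0.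
Qed.

(** The factor 2 symmetrizes the double sum over the copies j and l: the pairs
    j != l contribute X Y + Y X each, and the diagonal contributes 2 X Y. *)
Lemma cumulant2 (X Y : A) : cumulant (tnth [tuple X; Y]) *+ 2 = X * Y - Y * X.
Proof.
set Z := tnth _; rewrite /cumulant -coefMn.
suff -> : phi_sum_poly Z *+ 2 = (X * Y + Y * X)%:P * 'X^2 + (X * Y - Y * X)%:P * 'X.
  by rewrite coefD !coefCM coefXn coefX mulr0 mulr1 add0r.
apply: poly_nat_inj => N _.
rewrite hornerMn phi_sum_poly_horner hornerD !hornerCM hornerXn hornerX.
rewrite /phi_sum !big_ord_recl big_ord0 mulr1 big_distrlr /= linear_sum.
have pairE (i j : 'I_N) :
    phi_tilde (incl i X * incl j Y) + phi_tilde (incl j X * incl i Y) =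
    (X * Y + Y * X) + (if i == j then X * Y - Y * X else 0).
  rewrite !phi_tilde_incl2 -val_eqE /=.
  case: ltngtP => _; rewrite ?addr0 //; first by rewrite addrC.
  by rewrite addrACA subrr addr0.
under eq_bigr do rewrite linear_sum.
rewrite mulr2n {2}exchange_big -big_split /=.
transitivity (\sum_(i < N) ((X * Y + Y * X) *+ N + (X * Y - Y * X))).
  apply: eq_bigr => i _; rewrite -big_split /=.
  under eq_bigr do rewrite pairE.
  rewrite big_split sumr_const card_ord -big_mkcond /=.
  by under eq_bigl do rewrite eq_sym; rewrite big_pred1_eq.
by rewrite sumr_const card_ord mulrnDl -natrX !mulr_natr -mulrnA.
Qed.

Lemma cumulant2_eq0 (X Y : A) :
  cumulant (tnth [tuple X; Y]) = 0 <-> X * Y = Y * X.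
Proof.
split=> [K2|XY].
  by apply/eqP; rewrite -subr_eq0 -cumulant2 K2 mul0rn.
apply/eqP; have /eqP := cumulant2 X Y.
by rewrite XY subrr -scaler_nat scaler_eq0 pnatr_eq0.
Qed.

End Cumulants.

Theorem proposition6p8 (R : realType) (A : algType R[i]) :
  (forall B : nat -> {pred A}, (forall i, subalgebra (B i)) ->
     (S_independent B <->
      (forall i j, i != j ->
       forall X Y : A, X \in B i -> Y \in B j -> X * Y = Y * X)) /\
     ((forall i j, i != j ->
       forall X Y : A, X \in B i -> Y \in B j -> X * Y = Y * X) <->
      (forall i j, i != j ->
       forall X Y : A, X \in B i -> Y \in B j ->
       cumulant (tnth [tuple X; Y]) = 0))) /\
  (forall (n : nat) (X : 'I_n -> A), (2 <= n)%N ->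
     (exists I : {set 'I_n}, [/\ I != set0, I \proper [set: 'I_n] &
        forall i j, i \in I -> j \notin I -> X i * X j = X j * X i]) ->
     cumulant X = 0).
Proof.
split=> [B _|n X _ [I [I0 IT commX]]]; last exact: cumulant_split0 commX.
split; split; [exact: S_independent_comm|exact: comm_S_independent|..].
  move=> commB i j ij X Y BX BY; apply/cumulant2_eq0; exact: commB BX BY.
by move=> K2 i j ij X Y BX BY; apply/cumulant2_eq0; apply: K2 BX BY.
Qed.
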